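(* Fix a nominal state-control pair $p_k=(z_k,v_k)\in\mathbb{R}^{n_x+n_u}$ and calibration pairs $(x_i,u_i)$, $i=1,\dots,n$, with $n\ge 2$. Let $d_i:=\|[z_k^\top,v_k^\top]-[x_i^\top,u_i^\top]\|_2$ and assume the indices are ordered so that $d_1\le d_2\le\dots\le d_n$. Put $d_{\min}:=\min_{1\le i\le n-1}(d_{i+1}-d_i)$ and $d_{\max}:=\max_{1\le i\le n-1}(d_{i+1}-d_i)$, and assume $d_{\min}>0$. Let $\rho\in(0,1)$ and $\tilde w_i:=\rho^{d_i}/(1+\sum_{j=1}^n\rho^{d_j})$. Let $s_{1,k},\dots,s_{n,k},s_{k,k}$ be mutually independent real-valued random variables, where $s_{i,k}\sim S_{i,k}$ and $s_{k,k}\sim S_{k,k}$. Assume that for some $\epsilon>0$ and every $i$, $$d_{\mathrm{TV}}(S_{i,k},S_{k,k})\le \epsilon\, d_i .$$ Let $S^{k,k}$ be the joint law of $(s_{1,k},\dots,s_{n,k},s_{k,k})$, and let $S^{i,k}$ be the joint law of the vector obtained from it by swapping the entries $s_{i,k}$ and $s_{k,k}$. Then the coverage gap $\sum_{i=1}^n\tilde w_i\, d_{\mathrm{TV}}(S^{i,k},S^{k,k})$ satisfies $$\sum_{i=1}^n\tilde w_i\, d_{\mathrm{TV}}(S^{i,k},S^{k,k})\;\le\;\sum_{i=1}^n\frac{\rho^{d_i}}{1+\sum_{j=1}^n\rho^{d_j}}\cdot 2\epsilon\, d_i\;\le\;2\epsilon\left[\frac{d_1}{1-\rho^{d_{\m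in}}}+\frac{d_{\max}\,\rho^{d_{\min}}}{(1-\rho^{d_{\min}})^2}\right].$$
   Context: $d_{\mathrm{TV}}$ denotes the total-variation distance between probability distributions. The random variables are interpreted as nonconformity scores: $s_{i,k}$ is the score of calibration point $i$, and $s_{k,k}$ is the (unknown) score at the nominal point $(z_k,v_k)$. The normalized weights $\tilde w_i$ come from the unnormalized weights $w_i=\rho^{d_i}$ together with a test weight $w_{\mathrm{test}}=1$. The test point receives normalized weight $\tilde w_{\mathrm{test}}=1/(1+\sum_j\rho^{d_j})$. *)

(* Defs.v *)
From HB Require Import structures.
From mathcomp Require Import all_boot all_order all_algebra.
From mathcomp Require Import all_classical all_reals all_analysis.
Set Implicit Arguments. Unset Strict Implicit. Unset Printing Implicit Defensive.
Import Order.TTheory GRing.Theory Num.Theory.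
Local Open Scope classical_set_scope.
Local Open Scope ring_scope.

Section Defs.
Context {R : realType}.

Definition euclid N (p : 'rV[R]_N) : R := Num.sqrt (\sum_(j < N) (p 0 j) ^+ 2).

Definition dist_pt nx nu (z : 'rV[R]_nx) (v : 'rV[R]_nu) (x : 'rV[R]_nx) (u : 'rV[R]_nu) : R :=
  euclid (row_mx z v - row_mx x u).

Definition dseq n (d : 'I_n -> R) : seq R := [seq d i | i <- enum 'I_n].

Definition dfirst n (d : 'I_n -> R) : R := head 0 (dseq d).

Definition dgaps n (d : 'I_n -> R) : seq R :=
  behead (pairmap (fun a b => b - a) 0 (dseq d)).

Definition dmin n (d : 'I_n -> R) : R :=
  \big[Num.min/head 0 (dgaps d)]_(g <- dgaps d) g.
Definition dmax n (d : 'I_n -> R) : R :=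
  \big[Num.max/head 0 (dgaps d)]_(g <- dgaps d) g.

Definition wtilde n (rho : R) (d : 'I_n -> R) (i : 'I_n) : R :=
  rho `^ d i / (1 + \sum_(j < n) rho `^ d j).

End Defs.

Section Prob.
Context {d0 : measure_display} {T : measurableType d0} {R : realType}.
Variable P : probability T R.

Definition mutually_independent m (X : 'I_m -> T -> R) : Prop :=
  forall (J : {set 'I_m}) (B : 'I_m -> set R),
    (forall j, measurable (B j)) ->
    P (\big[setI/setT]_(j in J) (X j @^-1` B j)) =
    (\prod_(j in J) P (X j @^-1` B j))%E.

Definition dTV_law U (G : set (set U)) (Y Y' : T -> U) : \bar R :=
  ereal_sup [set `| P (Y @^-1` A) - P (Y' @^-1` A) |%E | A in G].

End Prob.

Definition prod_sigma (R : realType) m : set (set ('I_m -> R)) :=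
  <<s \bigcup_(j in [set: 'I_m]) [set (fun f : 'I_m -> R => f j) @^-1` B | B in (measurable : set (set R))] >>.

Definition joint (T R : Type) m (X : 'I_m -> T -> R) : T -> ('I_m -> R) :=
  fun w j => X j w.

Definition swapped (T R : Type) m (X : 'I_m -> T -> R) (a b : 'I_m) : T -> ('I_m -> R) :=
  fun w j => X (if j == a then b else if j == b then a else j) w.

(* Main.v *)
(* Let [nu] be the family of marginals.  Independence makes the joint law the
   product of [nu] and the swapped law the product of [nu] with [nu i] and
   [nu k] exchanged.  Redrawing one coordinate of a product law from a new
   marginal changes the probability of an event by at most the distance between
   the marginals, because the event's sections are events of the line.  The two
   laws become equal when the first has its coordinate i redrawn from [nu k] and
   the second its coordinate k redrawn from [nu k], so they are at distance at
   most 2 eps d_i.  The second inequality bounds the denominator below by 1 and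
   uses d_1 + (i-1) d_min <= d_i <= d_1 + (i-1) d_max, which leaves geometric and
   arithmetico-geometric sums in q = rho^d_min. *)
Require Import Defs.
From HB Require Import structures.
From mathcomp Require Import all_boot all_order all_algebra.
From mathcomp Require Import all_classical all_reals all_analysis.
From mathcomp Require Import ring lra.
Set Implicit Arguments. Unset Strict Implicit. Unset Printing Implicit Defensive.
Import Order.TTheory GRing.Theory Num.Theory.
Local Open Scope classical_set_scope.
Local Open Scope ring_scope.

(** * The product sigma-algebra, and laws determined by their values on boxes *)

Definition prod_space (R : realType) (m : nat) : Type := 'I_m -> R.

Section prod_space.
Variables (R : realType) (m : nat).

HB.instance Definition _ := Choice.copy (prod_space R m) ('I_m -> R).
HB.instance Definition _ := isPointed.Build (prod_space R m) (fun=> 0).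
(** Taking [prod_sigma] itself as the measurable sets makes them exactly the events over which
    [dTV_law] ranges for joint laws. *)
HB.instance Definition _ := @isMeasurable.Build default_measure_display
  (prod_space R m) (@prod_sigma R m) (@sigma_algebra0 _ _ _)
  (@sigma_algebraC _ _) (@sigma_algebra_bigcup _ _ _).

Definition box (B : 'I_m -> set R) : set (prod_space R m) :=
  [set f | forall j, B j (f j)].

Definition boxes : set (set (prod_space R m)) :=
  [set A | exists2 B, (forall j, measurable (B j)) & A = box B].

Lemma measurable_coord (j : 'I_m) :
  measurable_fun [set: prod_space R m] (fun f : prod_space R m => f j).
Proof.
move=> _ B mB; rewrite setTI; apply: sub_sigma_algebra.
by exists j => //; exists B.
Qed.

Lemma measurable_to_prod_space d (T : measurableType d)
    (f : T -> prod_space R m) :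
  (forall j, measurable_fun [set: T] (f ^~ j)) -> measurable_fun [set: T] f.
Proof.
move=> mf; apply: measurability; first by [].
move=> _ [_ [j _ [B mB <-]] <-].
by apply: (mf j).
Qed.

Lemma measurable_box (B : 'I_m -> set R) :
  (forall j, measurable (B j)) -> measurable (box B).
Proof.
move=> mB.
rewrite (_ : box B =
    \bigcap_(j in [set: 'I_m]) ((fun f : prod_space R m => f j) @^-1` B j)).
  apply: fin_bigcap_measurable; first exact: finite_finset.
  by move=> j _; rewrite -[_ @^-1` _]setTI; exact: measurable_coord.
by apply/seteqP; split=> f fB j; [move=> _|]; exact: fB.
Qed.

Lemma measurable_boxesE : measurable = <<s boxes >>.
Proof.
apply/seteqP; split.
  apply: smallest_sub; first exact: smallest_sigma_algebra.
  move=> _ [j _ [B mB <-]]; apply: sub_sigma_algebra.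
  exists (fun k => if k == j then B else setT).
    by move=> k; case: ifP.
  apply/seteqP; split=> f /=.
    by move=> fB k; case: eqP => // ->.
  by move=> /(_ j); rewrite eqxx.
apply: smallest_sub; first exact: sigma_algebra_measurable.
by move=> _ [B mB ->]; exact: measurable_box.
Qed.

(** The product measure of the family [nu], characterised on boxes instead of being constructed. *)
Definition prod_law (Q : set (prod_space R m) -> \bar R)
    (nu : 'I_m -> set R -> \bar R) :=
  forall B, (forall j, measurable (B j)) ->
    Q (box B) = (\prod_j nu j (B j))%E.

(** Boxes are closed under intersection, generate the sigma-algebra and include the whole space, so
    the pi-lambda argument applies; total mass 1 supplies finiteness. *)
Lemma prod_law_unique (Q1 Q2 : {measure set (prod_space R m) -> \bar R}) nu :
  Q1 setT = 1%E -> prod_law Q1 nu -> prod_law Q2 nu ->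
  forall A, measurable A -> Q1 A = Q2 A.
Proof.
move=> Q11 pQ1 pQ2 A mA.
apply: (measure_unique boxes (fun=> setT)) => //.
- exact: measurable_boxesE.
- move=> _ _ [B mB ->] [C mC ->]; exists (fun j => B j `&` C j).
    by move=> j; exact: measurableI.
  by apply/seteqP; split=> f /=; [move=> [fB fC] j|move=> fBC; split=> j];
    [split; [exact: fB|exact: fC]|case: (fBC j)..].
- move=> _; exists (fun=> setT) => //.
  by apply/seteqP; split.
- by rewrite bigcup_const.
- by move=> _ [B mB ->]; rewrite pQ1// pQ2.
- by move=> _; rewrite Q11 ltry.
Qed.

Definition replace (a : 'I_m) (p : prod_space R m * R) : prod_space R m :=
  fun j => if j == a then p.2 else p.1 j.

Lemma measurable_replace a : measurable_fun setT (replace a).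
Proof.
apply: measurable_to_prod_space => j; rewrite /replace.
case: eqP => _; first exact: measurable_snd.
exact: (measurableT_comp (measurable_coord j) measurable_fst).
Qed.

End prod_space.

(** * Redrawing one coordinate independently *)

Section resample.
Local Open Scope ereal_scope.
Variables (R : realType) (m : nat) (a : 'I_m).
Variables (Q : probability (prod_space R m) R).

Definition resample (mu : probability R R) :=
  pushforward (Q \x mu) (@replace R m a).

Section resample_measure.
Variable mu : probability R R.

Let mr := @measurable_replace R m a.

Let resample0 : resample mu set0 = 0.
Proof. by rewrite /resample /pushforward preimage_set0 measure0. Qed.

Let resample_ge0 A : 0 <= resample mu A.
Proof. by rewrite /resample /pushforward; exact: measure_ge0. Qed.

Let resample_sigma_additive : semi_sigma_additive (resample mu).
Proof.
rewrite /resample; move: mr => mr'.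
exact: measure_semi_sigma_additive.
Qed.

HB.instance Definition _ := isMeasure.Build _ _ _ (resample mu)
  resample0 resample_ge0 resample_sigma_additive.
End resample_measure.

Lemma resampleT mu : resample mu setT = 1.
Proof.
rewrite /resample /pushforward preimage_setT -setXTT.
rewrite product_measure1E//=. by rewrite !probability_setT mule1.
Qed.

(** The preimage of a box under [replace a] is a rectangle: the box with side [a] opened to the
    whole line, times [B a]. The opened side contributes a factor 1. *)
Lemma prod_law_resample mu (nu : 'I_m -> probability R R) :
  prod_law Q nu -> prod_law (resample mu) (fun j => if j == a then mu else nu j).
Proof.
move=> pQ B mB; rewrite /resample /pushforward.
pose B' j := if j == a then setT else B j.
have mB' j : measurable (B' j) by rewrite /B'; case: ifP.
rewrite (_ : _ @^-1` _ = box B' `*` B a); last first.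
  apply/seteqP; split=> [[f r]|[f r]] /=; rewrite /box /replace /B' /=.
    move=> fB; split=> [j|]; last by have := fB a; rewrite eqxx.
    by have := fB j; case: eqP.
  by move=> [fB rB] j; have := fB j; case: eqP => // ->.
transitivity (Q (box B') * mu (B a)).
  by apply: product_measure1E => //; exact: measurable_box.
rewrite pQ// muleC [in LHS](bigD1 a)//= [in RHS](bigD1 a)//= /B' !eqxx.
rewrite probability_setT mul1e; congr (_ * _).
by apply: eq_bigr => j /negbTE ->.
Qed.

(** For each fixed draw from [Q], the new coordinate must fall in a section of the event, a Borel
    set to which the hypothesis applies. Integrating against [Q], of mass 1, keeps the constant
    [c]. *)
Lemma le_resample (mu mu' : probability R R) (c : R) A : (0 <= c)%R ->
  (forall B, measurable B -> mu B <= mu' B + c%:E) -> measurable A ->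
  resample mu A <= resample mu' A + c%:E.
Proof.
move=> c0 mumu' mA.
have mA' : measurable (replace a @^-1` A).
  by rewrite -[_ @^-1` _]setTI; exact: measurable_replace.
rewrite /resample /pushforward /product_measure1 /=.
have -> : c%:E = \int[Q]_x c%:E.
  by rewrite integral_cst//= probability_setT mule1.
rewrite -ge0_integralD//; last exact: measurable_fun_xsection.
apply: ge0_le_integral => //.
- exact: measurable_fun_xsection.
- by apply: emeasurable_funD => //; exact: measurable_fun_xsection.
- by move=> f _; apply: mumu'; exact: measurable_xsection.
Qed.

End resample.
Lemma abse_dist_le (R : realDomainType) (x y : \bar R) (c : R) :
  x \is a fin_num -> y \is a fin_num ->
  (`|x - y| <= c%:E)%E <-> (x <= y + c%:E)%E /\ (y <= x + c%:E)%E.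
Proof.
case: x => [x| |]// _; case: y => [y| |]// _.
rewrite -EFinB abse_EFin -!EFinD !lee_fin ler_norml.
by split=> [/andP[? ?]|[? ?]]; [split|apply/andP; split]; lra.
Qed.

(** * Exchanging two marginals of a product law *)

Section swap.
Variables (R : realType) (m : nat).

Definition swap_idx (a b j : 'I_m) : 'I_m :=
  if j == a then b else if j == b then a else j.

Lemma swap_idxK a b : involutive (swap_idx a b).
Proof.
move=> j; rewrite /swap_idx.
have [->|ja] := eqVneq j a; first by rewrite eqxx; case: eqP.
have [->|jb] := eqVneq j b; first by rewrite eqxx.
by rewrite (negbTE ja) (negbTE jb).
Qed.

Lemma swap_idxC a b : swap_idx a b =1 swap_idx b a.
Proof.
move=> j; rewrite /swap_idx; have [->|//] := eqVneq j a.
by case: eqP.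
Qed.

Local Open Scope ereal_scope.

Lemma le_prod_law_swap (Q1 Q2 : probability (prod_space R m) R)
    (nu : 'I_m -> probability R R) (a b : 'I_m) (c : R) :
  a != b -> (0 <= c)%R ->
  (forall B, measurable B -> nu a B <= nu b B + c%:E) ->
  (forall B, measurable B -> nu b B <= nu a B + c%:E) ->
  prod_law Q1 nu -> prod_law Q2 (nu \o swap_idx a b) ->
  forall A, measurable A -> Q1 A <= Q2 A + (2 * c)%:E.
Proof.
move=> ab c0 nuab nuba pQ1 pQ2 A mA.
(* Redrawing a coordinate from its own marginal leaves a product law unchanged. *)
have Q1E : Q1 A = resample a Q1 (nu a) A.
  apply: (@prod_law_unique _ _ _ _ nu) => //; first exact: probability_setT.
  move=> B mB; apply: etrans (prod_law_resample a (nu a) pQ1 mB) _.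
  by apply: eq_bigr => j _; case: eqP => // ->.
(* Same fact for [Q2], whose coordinate [b] has marginal [nu a] after the exchange. *)
have Q2E : resample b Q2 (nu a) A = Q2 A.
  apply: (@prod_law_unique _ _ _ _ (nu \o swap_idx a b)) => //.
  - exact: resampleT.
  - move=> B mB; apply: etrans (prod_law_resample b (nu a) pQ2 mB) _.
    apply: eq_bigr => j _; case: eqP => //= ->.
    by rewrite /swap_idx eqxx eq_sym (negbTE ab).
(* The common law: coordinates [a] and [b] both have marginal [nu b]. Each of [Q1] and [Q2] is one
   redraw away from it, at cost [c]. *)
have Q12 : resample a Q1 (nu b) A = resample b Q2 (nu b) A.
  apply: (@prod_law_unique _ _ _ _ (fun j => if j == a then nu b else nu j)) => //.
  - exact: resampleT.
  - exact: prod_law_resample.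
  - move=> B mB; apply: etrans (prod_law_resample b (nu b) pQ2 mB) _.
    apply: eq_bigr => j _ /=; rewrite /swap_idx.
    have [->|jb] := eqVneq j b; first by rewrite eq_sym (negbTE ab).
    by case: (j == a).
rewrite Q1E; apply: le_trans (le_resample a Q1 c0 nuab mA) _.
rewrite Q12; apply: le_trans (leeD2r c%:E (le_resample b Q2 c0 nuba mA)) _.
by rewrite Q2E -addeA -EFinD mulr2n mulrDl mul1r.
Qed.

End swap.

(** * Joint laws of independent variables *)

Section joint_law.
Local Open Scope ereal_scope.
Context {d0 : measure_display} {T : measurableType d0} {R : realType}.
Variable P : probability T R.

Lemma bounded_dTV_law (Y Y' : T -> R) (c : R) :
  measurable_fun setT Y -> measurable_fun setT Y' ->
  dTV_law P measurable Y Y' <= c%:E -> forall B, measurable B ->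
  P (Y @^-1` B) <= P (Y' @^-1` B) + c%:E /\ P (Y' @^-1` B) <= P (Y @^-1` B) + c%:E.
Proof.
move=> mY mY' /ereal_supP dTV B mB.
have mYB : measurable (Y @^-1` B) by rewrite -[_ @^-1` _]setTI; exact: mY.
have mYB' : measurable (Y' @^-1` B) by rewrite -[_ @^-1` _]setTI; exact: mY'.
by apply/abse_dist_le; rewrite ?fin_num_measure//; apply: dTV; exists B.
Qed.

Lemma joint_law m (X : 'I_m -> {RV P >-> R}) :
  {Q : probability (prod_space R m) R |
    forall A, Q A = P (joint (fun j => X j) @^-1` A)}.
Proof.
have mX : measurable_fun setT (joint (fun j => X j) : T -> prod_space R m).
  exact: measurable_to_prod_space.
pose X' : {mfun T >-> prod_space R m} := HB.pack
  (joint (fun j => X j) : T -> prod_space R m)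
  (isMeasurableFun.Build _ _ _ _ _ mX).
by exists (distribution P X').
Qed.

(** The reindexing [f] lets one statement serve the original vector, with the identity, and the
    swapped one, with a transposition. *)
Lemma prod_law_joint m (X : 'I_m -> {RV P >-> R}) (f : 'I_m -> 'I_m)
    (Q : probability (prod_space R m) R) :
  injective f -> mutually_independent P (fun j => X j) ->
  (forall A, Q A = P (joint (fun j => X (f j)) @^-1` A)) ->
  prod_law Q (fun j => distribution P (X (f j))).
Proof.
move=> f_inj indX QE B mB; rewrite QE.
(* Independence is stated for [X j], so the side [B j] meant for [X (f j)] has to be placed at index
   [f j]. *)
pose g := invF f_inj.
have := indX [set: 'I_m]%SET (B \o g) (fun j => mB (g j)).
rewrite (reindex_inj f_inj) [in X in _ = X](reindex_inj f_inj)/=.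
under eq_bigl do rewrite inE.
under [in X in _ = X]eq_bigl do rewrite inE.
under eq_bigr do rewrite /g invF_f.
under [in X in _ = X]eq_bigr do rewrite /g invF_f.
move=> <-; congr (P _).
rewrite -bigcap_seq; apply/seteqP; split=> w /=.
  by move=> wB j _; exact: wB.
by move=> wB j; apply: (wB j); rewrite /= mem_index_enum.
Qed.

End joint_law.

(** * Bounding the distances by multiples of the extreme gaps *)

Section gaps.
Context {R : realType} {n : nat}.
Variable d : 'I_n.+1 -> R.

Let size_dseq : size (dseq d) = n.+1.
Proof. by rewrite size_map size_enum_ord. Qed.

Let nth_dseq (k : 'I_n.+1) : nth 0 (dseq d) k = d k.
Proof. by rewrite (nth_map ord0) ?size_enum_ord// nth_ord_enum. Qed.

Lemma dfirstE : dfirst d = d ord0.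
Proof. by rewrite /dfirst -nth0 (nth_dseq ord0). Qed.

Lemma gap_dgaps (i j : 'I_n.+1) : j = i.+1 :> nat -> d j - d i \in dgaps d.
Proof.
move=> ji; have iltn : (i < n)%N by rewrite -ltnS -ji.
have szp : size (dgaps d) = n by rewrite size_behead size_pairmap size_dseq.
(* [pairmap] first lists the difference between the first distance and 0; [behead] drops it, so true
   gaps start at position 0. *)
have -> : d j - d i = nth 0 (dgaps d) i.
  rewrite nth_behead (nth_pairmap 0) ?size_dseq ?ltnS//=.
  by rewrite nth_dseq -ji nth_dseq.
by rewrite mem_nth// szp.
Qed.

Lemma dmin_dmax_step (i j : 'I_n.+1) : j = i.+1 :> nat ->
  dmin d <= d j - d i <= dmax d.
Proof.
move=> /gap_dgaps ij.
by rewrite /dmin /dmax (ge_bigmin_seq _ (d j - d i))// (le_bigmax_seq _ (d j - d i)).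
Qed.

(** Telescoping: ordinals start at 0, so [i] counts the gaps between the first point and point
    [i]. *)
Lemma dmin_dmax_le (i : 'I_n.+1) :
  dmin d * i%:R <= d i - dfirst d <= dmax d * i%:R.
Proof.
rewrite dfirstE; case: i => i; elim: i => [|i IH] ltin.
  by rewrite (_ : Ordinal ltin = ord0) ?subrr ?mulr0 ?lexx//; exact: val_inj.
have /andP[l1 l2] := IH (ltnW ltin).
have /andP[g1 g2] := @dmin_dmax_step (Ordinal (ltnW ltin)) (Ordinal ltin) erefl.
rewrite /= -natr1 !mulrDr !mulr1 in l1 l2 *.
by apply/andP; split; lra.
Qed.

End gaps.

(** * Geometric and arithmetico-geometric sums *)

Section geometric.
Variables (R : realFieldType) (q : R).
Hypotheses (q_ge0 : 0 <= q) (q_lt1 : q < 1).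

Lemma sum_geom_le n : \sum_(i < n) q ^+ i <= (1 - q)^-1.
Proof.
have q1 : 0 < 1 - q by rewrite subr_gt0.
rewrite -(ler_pM2l q1) divff ?gt_eqF// -opprB mulNr -subrX1 opprB.
by rewrite gerBl exprn_ge0.
Qed.

Lemma sum_arith_geom_le n : \sum_(i < n) i%:R * q ^+ i <= q / (1 - q) ^+ 2.
Proof.
have q1 : 0 < 1 - q by rewrite subr_gt0.
(* Summation by parts, kept as an exact identity for the induction; the nonnegative boundary term is
   dropped afterwards. *)
have H : (1 - q) * (\sum_(i < n) i%:R * q ^+ i) + n%:R * q ^+ n
    = q * \sum_(i < n) q ^+ i.
  elim: n => [|n IH]; first by rewrite !big_ord0 !mul0r !mulr0 addr0.
  by rewrite !big_ord_recr/= mulrDr [RHS]mulrDr -IH -natr1 exprS; ring.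
have H2 : (1 - q) * (\sum_(i < n) i%:R * q ^+ i) <= q / (1 - q).
  apply: le_trans (ler_wpM2l q_ge0 (sum_geom_le n)).
  by rewrite -H lerDl mulr_ge0// exprn_ge0.
by rewrite expr2 invfM mulrA ler_pdivlMr// mulrC.
Qed.

End geometric.

Lemma weighted_sum_le (R : realType) n (d : 'I_n -> R) (rho : R) :
  (1 < n)%N -> (forall i, 0 <= d i) -> 0 < dmin d -> 0 < rho < 1 ->
  \sum_(i < n) rho `^ d i / (1 + \sum_(j < n) rho `^ d j) * d i
   <= dfirst d / (1 - rho `^ dmin d)
      + dmax d * rho `^ dmin d / (1 - rho `^ dmin d) ^+ 2.
Proof.
case: n d => // n d n0 d0 dmin0 /andP[rho0 rho1]; set q := rho `^ dmin d.
have q0 : 0 <= q by exact: powR_ge0.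
have q1 : q < 1.
  by rewrite /q /powR gt_eqF// expR_lt1 pmulr_rlt0// ln_lt0// rho0.
(* At least two points exist, so the gap between indices 0 and 1 lies between [dmin d] and
   [dmax d]. *)
have dmax0 : 0 <= dmax d.
  have /andP[] := @dmin_dmax_step _ _ d (inord 0) (inord 1) ltac:(by rewrite !inordK).
  by move=> /(lt_le_trans dmin0)/ltW/le_trans; exact.
have W (i : 'I_n.+1) : rho `^ d i / (1 + \sum_(j < n.+1) rho `^ d j) * d i <=
    dfirst d * q ^+ i + dmax d * (i%:R * q ^+ i).
  have /andP[lo up] := dmin_dmax_le d i.
  have df0 : 0 <= dfirst d by rewrite dfirstE.
  rewrite [X in _ <= _ + X]mulrA -mulrDl [leRHS]mulrC.
  have S0 : 0 <= \sum_(j < n.+1) rho `^ d j.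
    by apply: sumr_ge0 => j _; exact: powR_ge0.
  apply: ler_pM => //; [by rewrite divr_ge0 ?powR_ge0 ?addr_ge0| |by lra].
  rewrite ler_pdivrMr ?ltr_wpDr//.
  (* Since [rho < 1] and [d i] is at least [dmin d * i], the power of [rho] is at most [q ^+ i]; the
     denominator is at least 1. *)
  apply: (@le_trans _ _ (q ^+ i)).
    rewrite /q -powR_mulrn ?powR_ge0// -powRrM.
    apply: ger_powR; first by rewrite rho0 ltW.
    by lra.
  by rewrite ler_peMr ?exprn_ge0// lerDl.
apply: (le_trans (ler_sum _ (fun i _ => W i))).
rewrite big_split/= -!mulr_sumr -mulrA lerD// ler_wpM2l//.
- by rewrite dfirstE.
- exact: sum_geom_le.
- exact: sum_arith_geom_le.
Qed.

(** * Total variation between the joint law and its swapped version *)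

Section swapped.
Local Open Scope ereal_scope.
Context {d0 : measure_display} {T : measurableType d0} {R : realType}.
Variable P : probability T R.

Lemma dTV_swapped_le m (X : 'I_m -> {RV P >-> R}) (a b : 'I_m) (c : R) :
  mutually_independent P (fun j => X j) -> a != b -> (0 <= c)%R ->
  dTV_law P measurable (X a) (X b) <= c%:E ->
  dTV_law P (@prod_sigma R m) (swapped (fun j => X j) a b)
    (joint (fun j => X j)) <= (2 * c)%:E.
Proof.
move=> indX ab c0 dTV.
have [Q1 Q1E] := joint_law X.
have [Q2 Q2E] := joint_law (X \o swap_idx a b).
pose nu j : probability R R := distribution P (X j).
have pQ1 : prod_law Q1 nu by exact: (@prod_law_joint _ _ _ P m X id).
have pQ2 : prod_law Q2 (nu \o swap_idx a b).
  apply: (@prod_law_joint _ _ _ P m X (swap_idx a b)) => //.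
  exact: inv_inj (swap_idxK a b).
have nuD B : measurable B ->
    nu a B <= nu b B + c%:E /\ nu b B <= nu a B + c%:E.
  exact: (bounded_dTV_law (measurable_funPT (X a)) (measurable_funPT (X b)) dTV).
apply: ge_ereal_sup => _ [A mA <-].
rewrite -[P (swapped _ _ _ @^-1` A)]Q2E -Q1E.
apply/abse_dist_le; [exact: fin_num_measure..|split].
  (* The reverse one-sided bound comes from the same lemma, because swapping is an involution: [Q1]
     is the swap of [Q2]. *)
  apply: (@le_prod_law_swap _ _ Q2 Q1 (nu \o swap_idx a b) b a) => //=.
  - by rewrite eq_sym.
  - by rewrite /swap_idx !eqxx eq_sym (negbTE ab) => B /nuD[].
  - by rewrite /swap_idx !eqxx eq_sym (negbTE ab) => B /nuD[].
  - by move=> B mB; rewrite pQ1//; apply: eq_bigr => j _; rewrite /= swap_idxC swap_idxK.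
by apply: (le_prod_law_swap ab c0 _ _ pQ1 pQ2) => // B /nuD[].
Qed.

End swapped.

(* Random variables are indexed by 'I_n.+1: index (widen_ord _ i) for i : 'I_n is the
   calibration score s_{i+1,k}, and index ord_max is the test score s_{k,k}. *)
Theorem theorem3 (R : realType) (nx nu n : nat) (hn : (2 <= n)%N)
    (z : 'rV[R]_nx) (v : 'rV[R]_nu) (x : 'I_n -> 'rV[R]_nx) (u : 'I_n -> 'rV[R]_nu)
    (hsort : forall i j : 'I_n, (i <= j)%N ->
       dist_pt z v (x i) (u i) <= dist_pt z v (x j) (u j))
    (hdmin : 0 < dmin (fun i => dist_pt z v (x i) (u i)))
    (rho : R) (hrho0 : 0 < rho) (hrho1 : rho < 1)
    (d0 : measure_display) (T : measurableType d0) (P : probability T R)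
    (s : 'I_n.+1 -> {RV P >-> R})
    (hind : mutually_independent P (fun j => s j))
    (eps : R) (heps : 0 < eps)
    (hTV : forall i : 'I_n,
       (dTV_law P measurable (s (widen_ord (leqnSn n) i)) (s ord_max)
         <= (eps * dist_pt z v (x i) (u i))%:E)%E) :
  let d := fun i : 'I_n => dist_pt z v (x i) (u i) in
  ((\sum_(i < n) (wtilde rho d i)%:E *
      dTV_law P (@prod_sigma R n.+1)
        (swapped (fun j => s j) (widen_ord (leqnSn n) i) ord_max)
        (joint (fun j => s j)))
    <= (\sum_(i < n) rho `^ d i / (1 + \sum_(j < n) rho `^ d j) * (2 * eps * d i))%:E)%E
  /\
  \sum_(i < n) rho `^ d i / (1 + \sum_(j < n) rho `^ d j) * (2 * eps * d i)
    <= 2 * eps * (dfirst d / (1 - rho `^ dmin d)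
                  + dmax d * rho `^ dmin d / (1 - rho `^ dmin d) ^+ 2).
Proof.
move=> d; have d_ge0 i : 0 <= d i by exact: sqrtr_ge0.
split.
  rewrite -sumEFin; apply: lee_sum => i _; rewrite [leRHS]EFinM.
  apply: lee_wpmul2l.
    rewrite lee_fin divr_ge0 ?powR_ge0// addr_ge0// sumr_ge0// => j _.
    exact: powR_ge0.
  (* Regrouping as [2 * (eps * d i)] exposes the marginal distance bound [eps * d i] as the constant
     of a single redraw. *)
  rewrite -mulrA; apply: dTV_swapped_le => //.
  - by rewrite -val_eqE/= ltn_eqF.
  - by rewrite mulr_ge0// ltW.
under eq_bigr do rewrite mulrCA.
rewrite -mulr_sumr ler_wpM2l//; first by rewrite mulr_ge0// ltW.
by apply: weighted_sum_le => //; rewrite hrho0.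
Qed.
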